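(* Let $\mathcal{A}$ be a unital Banach $*$-algebra, let $\mathcal{M}$ be a unital $*$-$\mathcal{A}$-bimodule, and let $W\in\mathcal{A}$ be a left separating point of $\mathcal{M}$. If $\delta:\mathcal{A}\to\mathcal{M}$ is a linear mapping such that $$A,B\in\mathcal{A},\ AB^*=W \quad\Longrightarrow\quad \delta(W)=A\delta(B)^*+\delta(A)B^*,$$ then $\delta$ is a Jordan derivation and satisfies $\delta(WA)=\delta(W)A+W\delta(A^* )^*$ for each $A\in\mathcal{A}$.
   Context: Algebras are over the real or complex field. A $*$-$\mathcal{A}$-bimodule over a $*$-algebra $\mathcal{A}$ is an $\mathcal{A}$-bimodule $\mathcal{M}$ with a conjugate-linear map $M\mapsto M^*$ satisfying $M^{**}=M$, $(AM)^*=M^*A^*$, $(MA)^*=A^*M^*$ for $A\in\mathcal{A}$, $M\in\mathcal{M}$; it is unital if $IM=MI=M$, where $I$ is the unit of $\mathcal{A}$. $\delta(B)^*$ means $(\delta(B))^*$. No continuity of $\delta$ is assumed. An element $W\in\mathcal{A}$ is a left separating point of $\mathcal{M}$ if $WM=0$ implies $M=0$ for each $M\in\mathcal{M}$. A linear mapping $\delta:\mathcal{A}\to\mathcal{M}$ is a Jordan derivation if $\delta(A^2)=\delta(A)A+A\delta(A)$ for each $A\in\mathcal{A}$. *)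

(* Defs.v *)
From HB Require Import structures.
From mathcomp Require Import all_boot all_order all_algebra complex.
From mathcomp Require Import all_classical all_reals all_analysis.

Set Implicit Arguments.
Unset Strict Implicit.
Unset Printing Implicit Defensive.
Import Order.TTheory GRing.Theory Num.Theory.
Import numFieldNormedType.Exports.
Local Open Scope ring_scope.
Local Open Scope complex_scope.

Variant scalar_kind := RealScalars | ComplexScalars.

Definition scalars (R : realType) (k : scalar_kind) : numFieldType :=
  match k with
  | RealScalars => R
  | ComplexScalars => R[i]
  end.

Definition sconj (R : realType) (k : scalar_kind) : scalars R k -> scalars R k :=
  match k return scalars R k -> scalars R k with
  | RealScalars => id
  | ComplexScalars => fun z : R[i] => Num.conj z
  end.

HB.mixin Record isStarAlgebra (R : realType) (k : scalar_kind) A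
    of GRing.Algebra (scalars R k) A := {
  star : A -> A;
  starK : involutive star;
  starD : forall a b : A, star (a + b) = star a + star b;
  starZ : forall (c : scalars R k) (a : A), star (c *: a) = sconj c *: star a;
  starM : forall a b : A, star (a * b) = star b * star a
}.

#[short(type="starAlgType")]
HB.structure Definition StarAlgebra (R : realType) (k : scalar_kind) :=
  {A of isStarAlgebra R k A & GRing.Algebra (scalars R k) A}.

(* MathComp has no structure joining rings and normed spaces (such a join would
   have to lie above numDomainType), so the norm lives on the alias
   [normed_space A] of A, which carries the library's normed-module structure. *)
HB.mixin Record isNormedStarAlgebra (R : realType) (k : scalar_kind) A
    of StarAlgebra R k A := {
  alg_norm : A -> scalars R k;
  alg_normD : forall a b : A, alg_norm (a + b) <= alg_norm a + alg_norm b;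
  alg_normZ : forall (c : scalars R k) (a : A),
    alg_norm (c *: a) = `|c| * alg_norm a;
  alg_norm_eq0 : forall a : A, alg_norm a = 0 -> a = 0;
  alg_normM : forall a b : A, alg_norm (a * b) <= alg_norm a * alg_norm b
}.

#[short(type="normedStarAlgType")]
HB.structure Definition NormedStarAlgebra (R : realType) (k : scalar_kind) :=
  {A of isNormedStarAlgebra R k A & StarAlgebra R k A}.

Definition normed_space (R : realType) (k : scalar_kind)
  (A : normedStarAlgType R k) : Type := A.

Section NormedSpace.
Context (R : realType) (k : scalar_kind) (A : normedStarAlgType R k).
HB.instance Definition _ := GRing.Lmodule.on (normed_space A).
HB.instance Definition _ := Lmodule_isNormed.Build (scalars R k) (normed_space A)
  (@alg_normD R k A) (@alg_normZ R k A) (@alg_norm_eq0 R k A).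
End NormedSpace.

(* The involution is not required to be isometric or continuous, nor the unit
   to have norm 1. *)
HB.mixin Record isBanachStarAlgebra (R : realType) (k : scalar_kind) A
    of NormedStarAlgebra R k A := {
  banach_complete : forall F : set_system (normed_space A),
    ProperFilter F -> cauchy F -> cvg F
}.

#[short(type="banachStarAlgType")]
HB.structure Definition BanachStarAlgebra (R : realType) (k : scalar_kind) :=
  {A of isBanachStarAlgebra R k A & NormedStarAlgebra R k A}.

HB.instance Definition _ (R : realType) (k : scalar_kind)
    (A : banachStarAlgType R k) :=
  Uniform_isComplete.Build (normed_space A) (@banach_complete R k A).

HB.mixin Record isBimodule (R : realType) (k : scalar_kind)
    (A : starAlgType R k) M of GRing.Lmodule (scalars R k) M := {
  lact : A -> M -> M;
  ract : M -> A -> M;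
  lactDl : forall (a b : A) (m : M), lact (a + b) m = lact a m + lact b m;
  lactDr : forall (a : A) (m n : M), lact a (m + n) = lact a m + lact a n;
  lactZl : forall (c : scalars R k) (a : A) (m : M),
    lact (c *: a) m = c *: lact a m;
  lactZr : forall (c : scalars R k) (a : A) (m : M),
    lact a (c *: m) = c *: lact a m;
  lactM : forall (a b : A) (m : M), lact (a * b) m = lact a (lact b m);
  ractDl : forall (m n : M) (a : A), ract (m + n) a = ract m a + ract n a;
  ractDr : forall (m : M) (a b : A), ract m (a + b) = ract m a + ract m b;
  ractZl : forall (c : scalars R k) (m : M) (a : A),
    ract (c *: m) a = c *: ract m a;
  ractZr : forall (c : scalars R k) (m : M) (a : A),
    ract m (c *: a) = c *: ract m a;
  ractM : forall (m : M) (a b : A), ract m (a * b) = ract (ract m a) b;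
  lractA : forall (a : A) (m : M) (b : A), ract (lact a m) b = lact a (ract m b)
}.

#[short(type="bimodType")]
HB.structure Definition Bimodule (R : realType) (k : scalar_kind)
    (A : starAlgType R k) :=
  {M of isBimodule R k A M & GRing.Lmodule (scalars R k) M}.

HB.mixin Record isStarBimodule (R : realType) (k : scalar_kind)
    (A : starAlgType R k) M of @Bimodule R k A M := {
  mstar : M -> M;
  mstarK : involutive mstar;
  mstarD : forall m n : M, mstar (m + n) = mstar m + mstar n;
  mstarZ : forall (c : scalars R k) (m : M), mstar (c *: m) = sconj c *: mstar m;
  mstar_lact : forall (a : A) (m : M), mstar (lact a m) = ract (mstar m) (star a);
  mstar_ract : forall (a : A) (m : M), mstar (ract m a) = lact (star a) (mstar m)
}.

#[short(type="starBimodType")]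
HB.structure Definition StarBimodule (R : realType) (k : scalar_kind)
    (A : starAlgType R k) :=
  {M of isStarBimodule R k A M & @Bimodule R k A M}.

Section Notions.
Context (R : realType) (k : scalar_kind) (A : starAlgType R k).
Context (M : bimodType A).

Definition unital_bimodule : Prop :=
  forall m : M, lact (1 : A) m = m /\ ract m (1 : A) = m.

Definition left_separating (w : A) : Prop := forall m : M, lact w m = 0 -> m = 0.

Definition jordan_derivation (d : {linear A -> M}) : Prop :=
  forall a : A, d (a * a) = ract (d a) a + lact a (d a).

End Notions.

Arguments unital_bimodule {R k A} M.
Arguments left_separating {R k A} M w.
Arguments jordan_derivation {R k A M} d.

(* Main.v *)
Require Import Defs.
From HB Require Import structures.
From mathcomp Require Import all_boot all_order all_algebra complex.
From mathcomp Require Import all_classical all_reals all_analysis.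

Set Implicit Arguments.
Unset Strict Implicit.
Unset Printing Implicit Defensive.
Import Order.TTheory GRing.Theory Num.Theory.
Local Open Scope ring_scope.

(** Write [t a] for the adjoint of [delta] at the adjoint of [a]; it is additive,
    and the hypothesis on [delta] reads [delta W = a . t b + delta a . b] whenever
    [a * b = W].  Factoring [W = (W * a) * a^-1] turns it into

      [delta (W * a) - delta W . a = - W . (a . t (a^-1) . a)]

    for every invertible [a] ([right_defect_inverse]).  The left side is linear
    in [a], vanishes at [1], and in a Banach algebra every element differs from
    an invertible one by a scalar ([banach_shift_invertible]).  So its values all
    lie in [W . M] and, [W] being separating, it is [W . g a] for a unique linear
    [g] with [g 1 = 0] and [g a = - a . t (a^-1) . a] on invertible elements.

    That law relating the additive maps [g] and [t] is rigid.  When [x] and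
    [1 - x] are invertible, [(x - x^2)^-1 = x^-1 + (1 - x)^-1]; evaluating [g] at
    [x - x^2] through the law yields [g (x^2) = g x . x + x . g x]
    ([inverse_law_square]).  Shifting by large scalars extends this to all [x], so
    [g] is a Jordan derivation ([inverse_law_jordan]).  A Jordan derivation
    satisfies [g a = - a . g (a^-1) . a] ([is_jordan_inverse]), and comparing the
    two formulas gives [g = t] on invertible elements, hence everywhere
    ([inverse_law_eq]).  Thus [t] is a Jordan derivation, so is [delta], and
    [delta (W * a) - delta W . a = W . t a]. *)

(** * Jordan derivations into a bimodule *)

Definition inverses (A : pzRingType) (a b : A) : Prop := a * b = 1 /\ b * a = 1.

Section JordanMaps.
Context (R : realType) (k : scalar_kind) (A : starAlgType R k).
Context (M : bimodType A).

Lemma lactNl (a : A) (m : M) : lact (- a) m = - lact a m.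
Proof. by rewrite -scaleN1r lactZl scaleN1r. Qed.

Lemma lactNr (a : A) (m : M) : lact a (- m) = - lact a m.
Proof. by rewrite -scaleN1r lactZr scaleN1r. Qed.

Lemma ractNl (m : M) (a : A) : ract (- m) a = - ract m a.
Proof. by rewrite -scaleN1r ractZl scaleN1r. Qed.

Lemma ractNr (m : M) (a : A) : ract m (- a) = - ract m a.
Proof. by rewrite -scaleN1r ractZr scaleN1r. Qed.

Lemma lact0r (a : A) : lact a (0 : M) = 0.
Proof. by rewrite -(scale0r 0) lactZr !scale0r. Qed.

Lemma ract0l (a : A) : ract (0 : M) a = 0.
Proof. by rewrite -(scale0r 0) ractZl !scale0r. Qed.

(** Stated for plain functions, as it is needed of [star_twist delta], which
    carries only an additive structure. *)
Definition is_jordan (d : A -> M) : Prop :=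
  forall a : A, d (a * a) = ract (d a) a + lact a (d a).

Lemma is_jordan_polar (d : {additive A -> M}) (a b : A) : is_jordan d ->
  d (a * b + b * a) =
  (ract (d a) b + lact a (d b)) + (ract (d b) a + lact b (d a)).
Proof.
move=> dJ; have := dJ (a + b).
rewrite mulrDl !mulrDr !raddfD /= !ractDl !ractDr !lactDl !lactDr !dJ => e.
apply: (@addrI _ (ract (d a) a + lact a (d a) + (ract (d b) b + lact b (d b)))).
rewrite [LHS](AC (2*2) ((1*3)*(4*2))) /= e.
by rewrite [LHS](AC ((2*2)*(2*2)) (((1*5)*(4*8))*((2*6)*(3*7)))).
Qed.

Hypothesis unitalM : unital_bimodule M.

Lemma lact1 (m : M) : lact (1 : A) m = m. Proof. exact: (unitalM m).1. Qed.

Lemma ract1 (m : M) : ract m (1 : A) = m. Proof. exact: (unitalM m).2. Qed.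

Lemma is_jordan_one (d : {additive A -> M}) : is_jordan d -> d 1 = 0.
Proof.
move=> /(_ 1); rewrite mulr1 ract1 lact1 => e.
by apply: (@addrI _ (d 1)); rewrite -e addr0.
Qed.

(** In the Jordan product the inverse of [a] is determined by [a o b = 1] and
    [a^2 o b = a].  Applying the derivation rule to both, and multiplying the
    first by [a] on the left and on the right, everything cancels except
    [2 (d a + a . d b . a) = 0]. *)
Lemma is_jordan_inverse (d : {additive A -> M}) (a b : A) :
  is_jordan d -> inverses a b -> d a = - lact a (ract (d b) a).
Proof.
move=> dJ [ab ba]; have d1 := is_jordan_one dJ.
have := is_jordan_polar a b dJ.
rewrite ab ba raddfD /= d1 addr0 => /esym e1.
have := congr1 (@lact _ _ _ M a) e1.
rewrite !lactDr lact0r -(lactM a b) ab lact1 => e2.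
have := congr1 (fun m : M => ract m a) e1.
rewrite /= !ractDl ract0l -(ractM _ b a) ba ract1 !lractA => e3.
have := is_jordan_polar (a * a) b dJ.
rewrite -mulrA ab mulrA ba mulr1 mul1r raddfD /= !dJ.
rewrite !(ractDl, lactDr) -(ractM _ a b) ab ract1 -(lactM b a) ba lact1 => e4.
have {e4} : (d a + lact a (ract (d b) a)) *+ 2 = 0.
  rewrite addrC in e2; have {}e2 := addr0_eq e2; have {}e3 := addr0_eq e3.
  apply: oppr_inj; apply: (@addrI _ (d a + d a)); rewrite oppr0 addr0 [RHS]e4.
  rewrite mulr2n lractA lactM ractM in e2 e3 *.
  rewrite [RHS](AC (3*(1*2)) ((1*6)*((2*3)*(4*5)))) /= -e2 -e3.
  by rewrite [lact a (ract (d b) a) + d a]addrC -opprD.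
rewrite -scaler_nat => /eqP; rewrite scaler_eq0 pnatr_eq0 /=.
by rewrite addr_eq0 => /eqP.
Qed.

(** * The law [g a = - a . t (a^-1) . a] *)

Definition inverse_law (g t : A -> M) : Prop :=
  forall a b : A, inverses a b -> g a = - lact a (ract (t b) a).

(** Since [x (1 - x)] has inverse [y + z], the law and the additivity of [t]
    express [g (x (1 - x))] as [(1 - x) . g x . (1 - x) + x . g (1 - x) . x]; the
    cubic terms cancel. *)
Lemma inverse_law_square (g t : {additive A -> M}) (x y z : A) :
  g 1 = 0 -> inverse_law g t -> inverses x y -> inverses (1 - x) z ->
  g (x * x) = ract (g x) x + lact x (g x).
Proof.
move=> g1 gE xy1 xz1; have [xy yx] := xy1; have [xz zx] := xz1.
have xC : x * (1 - x) = (1 - x) * x by rewrite mulrBr mulrBl mulr1 mul1r.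
have xxyz : inverses (x * (1 - x)) (y + z).
  split; [rewrite mulrDr {1}xC | rewrite mulrDl {2}xC].
    by rewrite -!mulrA xy xz !mulr1 subrK.
  by rewrite !mulrA yx zx !mul1r subrK.
have g1x : g (1 - x) = - g x by rewrite raddfB /= g1 sub0r.
have : g (x * (1 - x)) =
    lact (1 - x) (ract (g x) (1 - x)) + lact x (ract (g (1 - x)) x).
  rewrite (gE _ _ xxyz) raddfD /= ractDl lactDr opprD (gE _ _ xy1) (gE _ _ xz1).
  by rewrite !(ractNl, lactNr) !lractA -!lactM -!ractM -xC.
rewrite g1x mulrBr mulr1 raddfB /= !(ractDr, lactDl, lactDr) !(ractNr, lactNl).
rewrite !(ractNl, lactNr, ract1, lact1) => e.
apply: oppr_inj; apply: (@addrI _ (g x)).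
by rewrite e opprK opprD !addrA addrK.
Qed.

(** The form in which completeness of the algebra enters: it supplies enough
    points at which [inverse_law_square] applies. *)
Definition shift_invertible : Prop := forall a : A, exists c : scalars R k,
  (exists y, inverses (c%:A + a) y) /\ (exists z, inverses (1 - (c%:A + a)) z).

Hypothesis shiftA : shift_invertible.

(** As [g 1 = 0], the Jordan identity at [c + a] is equivalent to the one at [a]. *)
Lemma inverse_law_jordan (g : {linear A -> M}) (t : {additive A -> M}) :
  g 1 = 0 -> inverse_law g t -> is_jordan g.
Proof.
move=> g1 gE a; have [c [[y xy] [z xz]]] := shiftA a.
have := inverse_law_square g1 gE xy xz.
rewrite mulrDl !mulrDr -!scalerAl !mul1r -scalerAr mulr1 !raddfD /= !linearZ /=.
rewrite g1 !scaler0 !add0r ractDr lactDl ractZr lactZl ract1 lact1 => e.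
apply: (@addrI _ (c *: g a + c *: g a)).
by rewrite -[LHS]addrA [LHS]e addrACA.
Qed.

(** The law applied at the inverse [b] computes [g b] from [t a], and the Jordan
    property computes [g a] from [g b]. *)
Lemma inverse_law_eq (g : {linear A -> M}) (t : {additive A -> M}) :
  g 1 = 0 -> inverse_law g t -> g =1 t.
Proof.
move=> g1 gE; have gJ := inverse_law_jordan g1 gE.
have gt a b : inverses a b -> g a = t a.
  move=> ab; have ba : inverses b a by case: ab.
  rewrite (is_jordan_inverse gJ ab) /= (gE _ _ ba) ractNl lactNr opprK.
  by rewrite lractA -ractM -lactM ab.1 ab.2 ract1 lact1.
move=> a; have [c [[y xy] [z xz]]] := shiftA a.
(* A nonzero scalar is itself invertible, so the agreement applies to it. *)
have tc : t c%:A = 0.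
  have [->|c0] := eqVneq c 0; first by rewrite scale0r raddf0.
  rewrite -(gt _ (c^-1)%:A); first by rewrite linearZ /= g1 scaler0.
  by split; rewrite -scalerAl mul1r scalerA ?divff ?mulVf ?scale1r.
by have := gt _ _ xy; rewrite !raddfD /= tc linearZ /= g1 scaler0 !add0r.
Qed.

(** * The defect of right multiplication *)

Lemma left_separating_inj (w : A) : left_separating M w ->
  forall m n : M, lact w m = lact w n -> m = n.
Proof.
move=> sepw m n e; apply/eqP; rewrite -subr_eq0; apply/eqP; apply: sepw.
by rewrite lactDr lactNr e subrr.
Qed.

(** Uniqueness of the preimage under [lact w] makes the chosen lift linear. *)
Lemma left_separating_lift (w : A) (f : {linear A -> M}) :
  left_separating M w -> (forall a, exists m, f a = lact w m) ->
  exists g : {linear A -> M}, forall a, f a = lact w (g a).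
Proof.
move=> sepw /choice[g fg].
have w_inj := left_separating_inj sepw.
have lin_g : linear g.
  move=> c a b; apply: w_inj.
  by rewrite -fg linearP lactDr lactZr -!fg.
pose mg := GRing.isLinear.Build _ _ _ _ g lin_g.
pose gl : {linear A -> M} := HB.pack g mg.
by exists gl.
Qed.

Section Factorization.
Variables (w : A) (d : {linear A -> M}) (t : {additive A -> M}).

Definition right_defect (a : A) : M := d (w * a) - ract (d w) a.

Lemma right_defect_linear : linear right_defect.
Proof.
move=> c a b; rewrite /right_defect mulrDr -scalerAr linearP ractDr ractZr.
by rewrite scalerBr opprD addrACA.
Qed.

HB.instance Definition _ :=
  GRing.isLinear.Build _ _ _ _ right_defect right_defect_linear.

Hypothesis dE : forall a b : A, a * b = w -> d w = lact a (t b) + ract (d a) b.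

(** The factorization [w = (w * a) * b], multiplied by [a] on the right. *)
Lemma right_defect_inverse (a b : A) : inverses a b ->
  right_defect a = - lact w (lact a (ract (t b) a)).
Proof.
move=> [ab ba]; have /dE e : (w * a) * b = w by rewrite -mulrA ab mulr1.
have := congr1 (fun m : M => ract m a) e.
rewrite /right_defect /= ractDl -ractM ba ract1 lractA lactM => ->.
by rewrite opprD addrCA subrr addr0.
Qed.

(** Shifting by a scalar, which leaves the defect unchanged, shows that all its
    values lie in [lact w M]; the lift then satisfies the inverse law. *)
Lemma right_defect_twist : left_separating M w ->
  (forall a, right_defect a = lact w (t a)) /\ is_jordan t.
Proof.
move=> sepw.
have f1 : right_defect 1 = 0 by rewrite /right_defect mulr1 ract1 subrr.
have [|g fg] := left_separating_lift (f := right_defect) sepw.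
  move=> a; have [c [[y xy] _]] := shiftA a.
  exists (- lact (c%:A + a) (ract (t y) (c%:A + a))).
  by rewrite lactNr -(right_defect_inverse xy) right_defect_linear f1 scaler0 add0r.
have w_inj := left_separating_inj sepw.
have g1 : g 1 = 0 by apply: w_inj; rewrite -fg /= f1 lact0r.
have gE : inverse_law g t.
  by move=> a b ab; apply: w_inj; rewrite -fg /= (right_defect_inverse ab) lactNr.
have gt := inverse_law_eq g1 gE.
split; first by move=> a; rewrite fg gt.
by move=> a; rewrite -!gt; apply: inverse_law_jordan gE a.
Qed.

End Factorization.
End JordanMaps.

(** * Conjugating a map by the involutions *)

Section StarTwist.
Context (R : realType) (k : scalar_kind) (A : starAlgType R k).
Context (M : starBimodType A).

Definition star_twist (d : A -> M) (a : A) : M := mstar (d (star a)).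

Lemma star0 : star (0 : A) = 0.
Proof. by apply: (@addrI _ (star (0:A))); rewrite -starD !addr0. Qed.

Lemma mstar0 : mstar (0 : M) = 0.
Proof. by apply: (@addrI _ (mstar (0:M))); rewrite -mstarD !addr0. Qed.

Lemma starN (a : A) : star (- a) = - star a.
Proof. by apply: (@addrI _ (star a)); rewrite -starD !subrr star0. Qed.

Lemma mstarN (m : M) : mstar (- m) = - mstar m.
Proof. by apply: (@addrI _ (mstar m)); rewrite -mstarD !subrr mstar0. Qed.

Lemma star_twist_additive (d : {additive A -> M}) : zmod_morphism (star_twist d).
Proof. by move=> a b; rewrite /star_twist starD starN raddfB mstarD mstarN. Qed.

HB.instance Definition _ (d : {additive A -> M}) :=
  GRing.isZmodMorphism.Build A M (star_twist d) (star_twist_additive d).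

Lemma is_jordan_star_twist (d : A -> M) : is_jordan (star_twist d) -> is_jordan d.
Proof.
move=> dJ a; have := congr1 (@mstar _ _ _ M) (dJ (star a)).
rewrite /star_twist !starM !starK !mstarK => ->.
by rewrite mstarD mstar_lact mstar_ract !mstarK starK addrC.
Qed.
End StarTwist.

(** * Invertible elements of a Banach algebra *)

Section Neumann.
Context (R : realType) (k : scalar_kind) (A : banachStarAlgType R k).
Local Notation K := (scalars R k).

(** A positive complex scalar is real, so the archimedean property of the reals
    covers both kinds of scalars. *)
Lemma scalar_half_pow_lt (e : K) : 0 < e -> exists n, 2^-1 ^+ n < e.
Proof.
have real_case (r : R) : 0 < r -> exists n, 2^-1 ^+ n < r.
  move=> r0; exists (Num.bound r^-1); rewrite exprVn.
  rewrite -{2}(invrK r) ltf_pV2 ?posrE ?invr_gt0 ?exprn_gt0 //.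
  by apply: upper_nthrootP.
rewrite /K; case: k e => /=; first exact: real_case.
move=> [a b]; rewrite ltcE /= => /andP[/eqP-> /real_case[n an]].
exists n; rewrite -[X in _ < X]/(real_complex R a) -(rmorph_nat (real_complex R)).
by rewrite -fmorphV -rmorphXn /= ltcR.
Qed.

Lemma alg_norm_ge0 (a : A) : 0 <= alg_norm a.
Proof. exact: (normr_ge0 (a : normed_space A)). Qed.

Lemma alg_norm0 : alg_norm (0 : A) = 0.
Proof. exact: (normr0 (normed_space A)). Qed.

Lemma alg_normN (a : A) : alg_norm (- a) = alg_norm a.
Proof. exact: (normrN (a : normed_space A)). Qed.

Lemma eq_of_alg_norm_lt (a b : A) :
  (forall e : K, 0 < e -> alg_norm (a - b) < e) -> a = b.
Proof.
move=> h; apply/eqP; rewrite -subr_eq0; apply/eqP/alg_norm_eq0/eqP.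
apply/contraT => n0; have := h (alg_norm (a - b)).
by rewrite lt_def n0 alg_norm_ge0 ltxx; apply.
Qed.

Variable x : A.
Hypothesis x_small : alg_norm x <= 2^-1.

(* The norm of the unit may exceed 1, and the power series starts at the unit. *)
Let C : K := alg_norm (1 : A).

Lemma alg_norm_pow n : alg_norm (x ^+ n) <= C * 2^-1 ^+ n.
Proof.
elim: n => [|n IH]; first by rewrite !expr0 mulr1.
rewrite !exprSr mulrA; apply: (le_trans (alg_normM _ _)).
by apply: ler_pM; rewrite ?alg_norm_ge0.
Qed.

(** Valued in [normed_space A], the alias of [A] that carries the topology. *)
Definition geometric_sum (n : nat) : normed_space A := \sum_(i < n) x ^+ i.

(** Each new term [x ^+ p] is at most [C * 2^-1 ^+ p], exactly the amount by which
    the remainder [2 * C * 2^-1 ^+ p] decreases. *)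
Lemma alg_norm_geometric_sum m n :
  alg_norm (geometric_sum (n + m) - geometric_sum n : A) + 2 * C * 2^-1 ^+ (n + m)
  <= 2 * C * 2^-1 ^+ n.
Proof.
elim: m => [|m IH]; first by rewrite addn0 subrr alg_norm0 add0r.
apply: le_trans IH; rewrite addnS /geometric_sum big_ord_recr /= addrAC.
apply: (le_trans (lerD (alg_normD _ _) (lexx _))).
rewrite -addrA lerD2l exprS mulrA (mulrAC 2) divff ?pnatr_eq0 // mul1r.
apply: (le_trans (lerD (alg_norm_pow _) (lexx _))).
by rewrite -mulrDl mulr_natl mulr2n.
Qed.

Lemma geometric_sum_limit :
  exists l : A, forall e : K, 0 < e -> exists n,
    alg_norm (l - geometric_sum n) < e /\ alg_norm (x ^+ n) < e.
Proof.
have C0 : 0 <= C := alg_norm_ge0 1.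
have C1 : 0 < 2 * C + 1 by rewrite ltr_wpDl // mulr_ge0.
have small (e : K) : 0 < e -> exists n, forall p, (n <= p)%N -> 2 * C * 2^-1 ^+ p < e.
  move=> e0; have [|n hn] := @scalar_half_pow_lt (e / (2 * C + 1)).
    by rewrite divr_gt0.
  exists n => p np; move: hn; rewrite ltr_pdivlMr // mulrC => hn.
  apply: le_lt_trans hn; apply: ler_pM.
  - by rewrite mulr_ge0.
  - by rewrite exprn_ge0.
  - by rewrite lerDl.
  - by apply: ler_wiXn2l => //; rewrite invf_le1 // ler1n.
have sc : cauchy (geometric_sum @ \oo)%classic.
  apply/cauchy_exP => e e0; have [n hn] := small e e0.
  exists (geometric_sum n); exists n => // m /= nm.
  rewrite -ball_normE /ball_ /= -normrN opprB.
  apply: le_lt_trans (hn n (leqnn _)).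
  rewrite -(subnKC nm); apply: le_trans (alg_norm_geometric_sum _ _).
  apply: ler_wpDr; last exact: lexx.
  by rewrite mulr_ge0 ?exprn_ge0 // mulr_ge0.
have [l sl] := (cvg_ex _).1 (@banach_complete _ _ A _ _ sc).
exists l => e e0.
have [N _ hN] := (cvgrPdist_lt _ _).1 sl _ e0.
have [n hn] := small e e0.
exists (maxn N n); split; first by apply: hN; exact: leq_maxl.
apply: le_lt_trans (hn _ (leq_maxr N n)); apply: le_trans (alg_norm_pow _) _.
by rewrite ler_wpM2r ?exprn_ge0 // mulr_natl mulr2n lerDl.
Qed.

(** Neumann series: [(1 - x) * geometric_sum n = 1 - x ^+ n], and likewise on the
    other side. *)
Lemma inverse_one_sub : exists y, inverses (1 - x) y.
Proof.
have [l hl] := geometric_sum_limit.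
have sC n : GRing.comm x (geometric_sum n : A).
  by apply: commr_sum => i _; apply: commrX.
have C0 : 0 < alg_norm (1 - x) + 1 by rewrite ltr_wpDl ?alg_norm_ge0.
(* [b] stands for either product of [1 - x] and [l]: the error of the partial
   sum and the power of [x] both tend to 0. *)
have bound (b : A) : (forall n, alg_norm (b - 1) <=
    alg_norm (1 - x) * alg_norm (l - geometric_sum n) + alg_norm (x ^+ n)) ->
    b = 1.
  move=> hb; apply: eq_of_alg_norm_lt => e e0.
  have [|n [h1 h2]] := hl (e / (alg_norm (1 - x) + 1)); first by rewrite divr_gt0.
  apply: le_lt_trans (hb n) _.
  rewrite -[ltRHS](divfK (lt0r_neq0 C0)) mulrDr mulr1.
  by apply: ler_ltD => //; rewrite mulrC ler_wpM2r ?alg_norm_ge0 // ltW.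
have tele n : (1 - x) * geometric_sum n = 1 - x ^+ n.
  by apply: oppr_inj; rewrite -mulNr !opprB subrX1.
exists l; split; apply: bound => n.
  have -> : (1 - x) * l - 1 = (1 - x) * (l - geometric_sum n) - x ^+ n.
    by rewrite mulrBr tele opprB [RHS]addrAC addrA subrK.
  apply: (le_trans (alg_normD _ _)).
  by rewrite alg_normN lerD2r alg_normM.
have -> : l * (1 - x) - 1 = (l - geometric_sum n) * (1 - x) - x ^+ n.
  rewrite mulrBl.
  have -> : geometric_sum n * (1 - x) = 1 - x ^+ n.
    by rewrite -tele mulrBl mulrBr mul1r mulr1 sC.
  by rewrite opprB [RHS]addrAC addrA subrK.
apply: (le_trans (alg_normD _ _)).
by rewrite alg_normN lerD2r mulrC alg_normM.
Qed.

End Neumann.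

Section Shift.
Context (R : realType) (k : scalar_kind) (A : banachStarAlgType R k).

Lemma inverse_scalar_sub (c : scalars R k) (a : A) :
  c != 0 -> 2 * alg_norm a <= `|c| -> exists y, inverses (c%:A - a) y.
Proof.
move=> c0 ac; have [|y [xy yx]] := @inverse_one_sub _ _ A (c^-1 *: a).
  rewrite alg_normZ normfV ler_pdivrMl ?normr_gt0 //.
  by rewrite ler_pdivlMr ?ltr0n // mulrC.
have -> : c%:A - a = c *: (1 - c^-1 *: a).
  by rewrite scalerBr scalerA divff // scale1r.
exists (c^-1 *: y); split; rewrite -scalerAl -scalerAr scalerA.
  by rewrite divff // scale1r.
by rewrite mulVf // scale1r.
Qed.

(** With [c = 2 |a| + 2], both [c] and [c - 1 = 2 |a| + 1] dominate [2 |a|]. *)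
Lemma banach_shift_invertible : shift_invertible A.
Proof.
move=> a; have a0 := alg_norm_ge0 a.
have b0 : 0 <= 2 * alg_norm a by rewrite mulr_ge0.
exists (2 * alg_norm a + 2); split.
  have -> : (2 * alg_norm a + 2)%:A + a = (2 * alg_norm a + 2)%:A - - a.
    by rewrite opprK.
  have c0 : 0 < 2 * alg_norm a + 2 by rewrite ltr_wpDl.
  apply: inverse_scalar_sub; first exact: lt0r_neq0.
  by rewrite alg_normN gtr0_norm // lerDl.
have c0 : 0 < 2 * alg_norm a + 1 by rewrite ltr_wpDl.
have -> : 1 - ((2 * alg_norm a + 2)%:A + a) = (- (2 * alg_norm a + 1))%:A - a.
  rewrite opprD addrA -{1}(scale1r (1 : A)) -scalerBl; congr (_%:A - a).
  by rewrite -[2 in LHS]/(1 + 1) addrA opprD addrCA subrr addr0.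
apply: inverse_scalar_sub; first by rewrite oppr_eq0 lt0r_neq0.
by rewrite normrN gtr0_norm // lerDl.
Qed.

End Shift.

(** * The theorem *)

Theorem theorem2p2 (R : realType) (k : scalar_kind)
  (A : banachStarAlgType R k) (M : starBimodType A)
  (unitalM : unital_bimodule M)
  (W : A) (sepW : left_separating M W)
  (delta : {linear A -> M})
  (hdelta : forall a b : A, a * star b = W ->
     delta W = lact a (mstar (delta b)) + ract (delta a) (star b)) :
  jordan_derivation delta /\
  (forall a : A, delta (W * a) = ract (delta W) a + lact W (mstar (delta (star a)))).
Proof.
have dE (a b : A) : a * b = W ->
    delta W = lact a (star_twist delta b) + ract (delta a) b.
  by rewrite /star_twist -{1 3}(starK b); apply: hdelta.
have [defect tJ] :=
  right_defect_twist unitalM (@banach_shift_invertible R k A) dE sepW.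
split; first exact: is_jordan_star_twist tJ.
by move=> a; apply/eqP; rewrite addrC -subr_eq; apply/eqP; apply: defect.
Qed.
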